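(* Let $q\in\mathbb{N}$, and for $i=1,\dots,q$ let $n_i\in\mathbb{N}$, $f_i:\mathbb{R}^{n_i}\to\mathbb{R}\cup\{+\infty\}$ be proper, closed, convex, and $A_i\in\mathbb{R}^{p\times n_i}$; let $c\in\mathbb{R}^p$. Consider $$\min_{x_1,\dots,x_q}\ \sum_{i=1}^q f_i(x_i)\quad\text{subject to}\quad \sum_{i=1}^q A_ix_i=c.$$ Assume that the Lagrangian $\mathcal{L}_0(x_1,\dots,x_q,y)=\sum_{i=1}^q f_i(x_i)+y^T(\sum_{i=1}^qA_ix_i-c)$ has a saddle point (max over $y\in\mathbb{R}^p$ of min over $x_i\in\mathbb{R}^{n_i}$ equals min over $x_i$ of max over $y$, and this saddle-point problem has a solution). Let $\rho\in[0,+\infty)$ and let $\tilde M_\rho$ be the block matrix whose $(i,j)$ block for $1\le i,j\le q$ is $\rho A_i^TA_j$, whose $(i,q+1)$ block is $A_i^T$ for $1\le i\le q$, whose $(q+1,j)$ block is $-A_j$ for $1\le j\le q$, and whose $(q+1,q+1)$ block is $0_{p\times p}$. Let $\tilde L>0$ satisfy $\|\tilde M_\rho\|_2\le\tilde L$ and let $\eta\in(0,\frac{1}{2\tilde L})$. For arbitrary initial points $x_{i,0},x_{i,-1}\in\mathbb{R}^{n_i}$ ($i=1,\dots,q$) and $y_0,y_{-1}\in\mathbb{R}^p$, define for $k=0,1,2,\dots$ and each $i=1,\dots,q$: $$\hat x_{i,k}=x_{i,k}-2\eta A_i^Ty_k-2\eta\rho\sum_{j=1}^qA_i^TA_jx_{j,k}+\eta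 A_i^Ty_{k-1}+\eta\rho\sum_{j=1}^qA_i^TA_jx_{j,k-1}+\eta\rho A_i^Tc,$$ $$x_{i,k+1}=\arg\min_{u_i\in\mathbb{R}^{n_i}}\Big(\eta f_i(u_i)+\tfrac12\|u_i-\hat x_{i,k}\|_2^2\Big),$$ $$y_{k+1}=y_k+2\eta\sum_{i=1}^qA_ix_{i,k}-\eta\sum_{i=1}^qA_ix_{i,k-1}-\eta c.$$ Then for each $i$ the sequence $\{x_{i,k}\}_{k\ge-1}$ converges, and the limit $(x_1^*,\dots,x_q^* )$ is a solution of the optimization problem.
   Context: $\|\cdot\|_2$ denotes the Euclidean norm on vectors and the spectral norm (largest singular value) on matrices. *)

(* Defs.v *)
From HB Require Import structures.
From mathcomp Require Import all_boot all_order all_algebra.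
From mathcomp Require Import all_classical all_reals all_analysis.
Set Implicit Arguments. Unset Strict Implicit. Unset Printing Implicit Defensive.
Import Order.TTheory GRing.Theory Num.Theory.
Import numFieldNormedType.Exports.
Local Open Scope classical_set_scope.
Local Open Scope ring_scope.

Section Defs.
Variable R : realType.

Definition dotv (m : nat) (u v : 'cV[R]_m) : R := (u^T *m v) 0 0.
Definition enorm2 (m : nat) (v : 'cV[R]_m) : R := \sum_(k < m) (v k 0) ^+ 2.
Definition enorm (m : nat) (v : 'cV[R]_m) : R := Num.sqrt (enorm2 v).

Definition specnorm (m n : nat) (M : 'M[R]_(m, n)) : R :=
  sup [set enorm (M *m z) | z in [set z : 'cV[R]_n | enorm z <= 1]].

Definition proper_fun (m : nat) (f : 'cV[R]_m -> \bar R) : Prop :=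
  (forall x, f x != -oo%E) /\ (exists x, f x \is a fin_num).

Definition closed_fun (m : nat) (f : 'cV[R]_m -> \bar R) : Prop :=
  closed [set xa : 'cV[R]_m * R | (f xa.1 <= xa.2%:E)%E].

Definition convex_fun (m : nat) (f : 'cV[R]_m -> \bar R) : Prop :=
  forall (x y : 'cV[R]_m) (t : R), 0 < t < 1 ->
    (f (t *: x + (1 - t) *: y)%R <= t%:E * f x + (1 - t)%:E * f y)%E.

Definition Mtilde (q p : nat) (n : 'I_q -> nat)
    (A : forall i : 'I_q, 'M[R]_(p, n i)) (rho : R) :
    'M[R]_(\sum_(i < q) n i + p) :=
  block_mx (\mxblock_(i < q, j < q) (rho *: ((A i)^T *m A j)))
           (\mxcol_(i < q) (A i)^T)
           (\mxrow_(j < q) (- A j))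
           (0 : 'M[R]_(p, p)).

Definition lagr0 (q p : nat) (n : 'I_q -> nat)
    (f : forall i : 'I_q, 'cV[R]_(n i) -> \bar R)
    (A : forall i : 'I_q, 'M[R]_(p, n i)) (c : 'cV[R]_p)
    (x : forall i : 'I_q, 'cV[R]_(n i)) (y : 'cV[R]_p) : \bar R :=
  (\sum_(i < q) f i (x i) + (dotv y (\sum_(i < q) A i *m x i - c))%:E)%E.

Definition is_solution (q p : nat) (n : 'I_q -> nat)
    (f : forall i : 'I_q, 'cV[R]_(n i) -> \bar R)
    (A : forall i : 'I_q, 'M[R]_(p, n i)) (c : 'cV[R]_p)
    (x : forall i : 'I_q, 'cV[R]_(n i)) : Prop :=
  \sum_(i < q) A i *m x i = c /\
  forall z : forall i : 'I_q, 'cV[R]_(n i),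
    \sum_(i < q) A i *m z i = c ->
    (\sum_(i < q) f i (x i) <= \sum_(i < q) f i (z i))%E.

End Defs.

(* Main.v *)
Require Import Defs.
From HB Require Import structures.
From mathcomp Require Import all_boot all_order all_algebra.
From mathcomp Require Import all_classical all_reals all_analysis.
From mathcomp Require Import ring lra.
Import Order.TTheory GRing.Theory Num.Theory.
Import numFieldNormedType.Exports.
Local Open Scope classical_set_scope.
Local Open Scope ring_scope.

(* Writing z = (x, y), the saddle points of the Lagrangian are the zeros of
   S + B, where S collects the subdifferentials of the f_i (and is 0 in the y
   direction) and B z = M z + b is affine and monotone with M = Mtilde.  The
   iteration is the forward-reflected-backward splitting
     z_{k+1} = (1 + eta S)^{-1} (z_k - 2 eta B z_k + eta B z_{k-1}).
   For any zero z* the quantity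
     |z_k - z*|^2 - 2 eta <M (z_k - z_{k-1}), z_k - z*> + |z_k - z_{k-1}|^2 / 2
   dominates |z_k - z*|^2 / 2 and decreases by at least a multiple of
   |z_{k+1} - z_k|^2 because 2 eta |M| < 1.  So (z_k) is bounded with vanishing
   increments, its cluster points are zeros since S has closed graph, and the
   same quantity taken at a cluster point tends to 0.  Cluster points are
   obtained as limits along an ultrafilter on nat, which avoids subsequences. *)

(** * Euclidean inner product and the spectral norm bound *)

Lemma dotvE {R : realType} {m} (u v : 'cV[R]_m) :
  dotv u v = \sum_(k < m) u k 0 * v k 0.
Proof. by rewrite /dotv mxE; apply: eq_bigr => k _; rewrite mxE. Qed.

Lemma enorm2E {R : realType} {m} (v : 'cV[R]_m) : enorm2 v = dotv v v.
Proof. by rewrite dotvE; apply: eq_bigr => k _; rewrite expr2. Qed.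

Lemma dotvC {R : realType} {m} (u v : 'cV[R]_m) : dotv u v = dotv v u.
Proof. by rewrite !dotvE; apply: eq_bigr => k _; rewrite mulrC. Qed.

Lemma dotvDl {R : realType} {m} (u v w : 'cV[R]_m) :
  dotv (u + v) w = dotv u w + dotv v w.
Proof. by rewrite /dotv linearD mulmxDl mxE. Qed.

Lemma dotvDr {R : realType} {m} (u v w : 'cV[R]_m) :
  dotv w (u + v) = dotv w u + dotv w v.
Proof. by rewrite /dotv mulmxDr mxE. Qed.

Lemma dotvNl {R : realType} {m} (u w : 'cV[R]_m) : dotv (- u) w = - dotv u w.
Proof. by rewrite /dotv linearN mulNmx mxE. Qed.

Lemma dotvNr {R : realType} {m} (u w : 'cV[R]_m) : dotv w (- u) = - dotv w u.
Proof. by rewrite /dotv mulmxN mxE. Qed.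

Lemma dotvZl {R : realType} {m} a (u w : 'cV[R]_m) :
  dotv (a *: u) w = a * dotv u w.
Proof. by rewrite /dotv linearZ -scalemxAl mxE. Qed.

Lemma dotvZr {R : realType} {m} a (u w : 'cV[R]_m) :
  dotv w (a *: u) = a * dotv w u.
Proof. by rewrite /dotv -scalemxAr mxE. Qed.

Lemma dotv0l {R : realType} {m} (w : 'cV[R]_m) : dotv 0 w = 0.
Proof. by rewrite /dotv trmx0 mul0mx mxE. Qed.

Definition dotv_lin := (@dotvDl, @dotvDr, @dotvNl, @dotvNr, @dotvZl, @dotvZr).

Lemma dotv_trmx {R : realType} {m p} (B : 'M[R]_(p, m)) u v :
  dotv (B^T *m u) v = dotv u (B *m v).
Proof. by rewrite /dotv trmx_mul trmxK mulmxA. Qed.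

Lemma dotv_ge0 {R : realType} {m} (v : 'cV[R]_m) : 0 <= dotv v v.
Proof. by rewrite -enorm2E sumr_ge0// => k _; exact: sqr_ge0. Qed.

Lemma sqr_entry_le {R : realType} {m} (v : 'cV[R]_m) i : v i 0 ^+ 2 <= dotv v v.
Proof.
by rewrite -enorm2E /enorm2 (bigD1 i)//= lerDl sumr_ge0// => k _; exact: sqr_ge0.
Qed.

(** Expanding |M u + L w|^2 >= 0 and |M u - L w|^2 >= 0 gives 2 L |<M u, w>| <= |M u|^2 + L^2 |w|^2;
    the bound on [M] and division by [L] finish. This form of the Lipschitz bound is free of square
    roots. *)
Lemma ler_dotv_lipschitz {R : realType} {m} (M : 'M[R]_m) (L : R) :
  0 < L -> (forall z, enorm2 (M *m z) <= L ^+ 2 * enorm2 z) ->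
  forall u w, 2 * `|dotv (M *m u) w| <= L * (dotv u u + dotv w w).
Proof.
move=> L0 ML u w; have := ML u; rewrite !enorm2E => Mu.
have := dotv_ge0 (M *m u + L *: w); have := dotv_ge0 (M *m u - L *: w).
rewrite !dotv_lin !(dotvC w (M *m u)).
move=> ? ?; rewrite -(ler_pM2l L0); case: ger0P => _; nra.
Qed.

Lemma specnorm_bound {R : realType} {m n} (M : 'M[R]_(m, n)) (L : R) :
  specnorm M <= L -> 0 < L -> forall z, enorm2 (M *m z) <= L ^+ 2 * enorm2 z.
Proof.
move=> ML L0 z.
have En0 k (v : 'cV[R]_k) : 0 <= enorm2 v by rewrite enorm2E dotv_ge0.
pose S := [set enorm (M *m z) | z in [set z : 'cV[R]_n | enorm z <= 1]].
(* [sup] dominates the image only if the image is bounded: entries of a vector of the unit ball are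
   at most 1 in absolute value, so the row sums of |M i j| give a bound. *)
have bS : has_ubound S.
  exists (Num.sqrt (\sum_(i < m) (\sum_(j < n) `|M i j|) ^+ 2)).
  move=> _ [v /= v1 <-]; rewrite ler_wsqrtr// ler_sum// => i _.
  rewrite -[leLHS]real_normK ?num_real// lerXn2r ?nnegrE ?sumr_ge0// mxE.
  apply: (le_trans (ler_norm_sum _ _ _)); apply: ler_sum => j _.
  rewrite normrM ler_piMr//.
  have v1' : dotv v v <= 1.
    by move: v1; rewrite /enorm enorm2E -{1}sqrtr1 ler_sqrt.
  have := le_trans (sqr_entry_le v j) v1'.
  by rewrite -real_normK ?num_real// expr_le1.
have [z0|z0] := eqVneq (enorm2 z) 0.
  suff -> : z = 0 by rewrite mulmx0 enorm2E dotv0l mulr_ge0// sqr_ge0.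
  apply/colP => i; rewrite mxE; apply/eqP.
  have := sqr_entry_le z i; rewrite -enorm2E z0 => zi.
  by rewrite -sqrf_eq0 eq_le zi sqr_ge0.
have zp : 0 < enorm2 z by rewrite lt_neqAle eq_sym z0 En0.
have sz : 0 < enorm z by rewrite sqrtr_gt0.
have sz2 : enorm z ^+ 2 = enorm2 z by rewrite sqr_sqrtr.
have enZ k a (v : 'cV[R]_k) : enorm2 (a *: v) = a ^+ 2 * enorm2 v.
  by rewrite !enorm2E !dotv_lin mulrA expr2.
have : enorm (M *m ((enorm z)^-1 *: z)) <= L.
  apply: le_trans ML; apply: ub_le_sup => //.
  exists ((enorm z)^-1 *: z) => //=.
  by rewrite [leLHS]/enorm enZ exprVn sz2 mulVf// sqrtr1.
rewrite -scalemxAr /enorm enZ -/(enorm z) => H.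
have : (enorm z)^-1 ^+ 2 * enorm2 (M *m z) <= L ^+ 2.
  rewrite -[leLHS]sqr_sqrtr ?(mulr_ge0 (sqr_ge0 _) (En0 _ _))//.
  by rewrite lerXn2r ?nnegrE ?sqrtr_ge0 ?(ltW L0).
by rewrite exprVn sz2 mulrC ler_pdivrMr.
Qed.

(** * Entrywise limits of matrices *)

Lemma cvg_mxP {T : Type} {U : topologicalType} {F : set_system T}
    {FF : Filter F} {m n} (f : T -> 'M[U]_(m, n)) (l : 'M[U]_(m, n)) :
  f @ F --> l <-> forall i j, f x i j @[x --> F] --> l i j.
Proof.
split=> [fl i j A lA|fl A [P lP PA]].
  apply: (fl [set B : 'M[U]_(m, n) | A (B i j)]).
  (* This family of neighbourhoods constrains the entry (i, j) alone: at any other index one of the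
     premises is false. *)
  exists (fun i' j' => [set u | i' = i -> j' = j -> A u]).
    move=> i' j'; have [->|/eqP ne] := eqVneq i' i; last by apply: nearW => u /ne.
    have [->|/eqP ne] := eqVneq j' j; last by apply: nearW => u _ /ne.
    by apply: filterS lA => u Au _ _.
  by move=> B /(_ i j)/(_ erefl erefl).
have : F [set x | forall i j, P i j (f x i j)].
  by apply: filter_forall => i; apply: filter_forall => j; exact: fl (lP i j).
by apply: (@filterS _ F) => x; exact: PA.
Qed.

Lemma cvg_dotv {R : realType} {T : Type} {F : set_system T} {FF : Filter F} {m}
    (u v : T -> 'cV[R]_m) a b :
  u @ F --> a -> v @ F --> b -> dotv (u x) (v x) @[x --> F] --> dotv a b.
Proof.
move=> /cvg_mxP ua /cvg_mxP vb; rewrite dotvE.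
under eq_fun do rewrite dotvE.
by apply: cvg_big => [|k _]; [exact: add_continuous | exact: cvgM].
Qed.

(** * The Lyapunov function of the splitting *)

Definition lyapunov {R : realType} {N} (M : 'M[R]_N) (eta : R)
    (zs z1 z0 : 'cV[R]_N) : R :=
  dotv (z1 - zs) (z1 - zs) - 2 * eta * dotv (M *m (z1 - z0)) (z1 - zs)
  + 2^-1 * dotv (z1 - z0) (z1 - z0).

(** With d = z1 - z0 and e = z1 - zs, the cross term is at most eta L (|d|^2 + |e|^2) <= (|d|^2 +
    |e|^2) / 2. The summand |d|^2 / 2 absorbs the part in d, and half of |e|^2 is left. *)
Lemma lyapunov_ge {R : realType} {N} (M : 'M[R]_N) (L eta : R) zs z1 z0 :
  0 < eta -> 2 * (eta * L) < 1 ->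
  (forall u w, 2 * `|dotv (M *m u) w| <= L * (dotv u u + dotv w w)) ->
  2^-1 * dotv (z1 - zs) (z1 - zs) <= lyapunov M eta zs z1 z0.
Proof.
move=> eta0 etaL ML; rewrite /lyapunov; have := ML (z1 - z0) (z1 - zs).
set d := z1 - z0; set e := z1 - zs; move=> H.
have := ler_wpM2l (ltW eta0) H; have := ler_norm (dotv (M *m d) e) => H1 H2.
have H3 := ler_wpM2l (ltW eta0) H1.
have : 2 * (eta * L) * (dotv d d + dotv e e) <= dotv d d + dotv e e.
  by rewrite ler_piMl ?addr_ge0 ?dotv_ge0// ltW.
lra.
Qed.

(** The last hypothesis is monotonicity of the set-valued part between [z2] and [zs]. Written with
    e, u, w below, twice eta times it, together with <M e, e> >= 0, controls every term except 2 eta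
    <M w, u>, which is at least - eta L (|u|^2 + |w|^2). *)
Lemma lyapunov_step {R : realType} {N} (M : 'M[R]_N) (b : 'cV[R]_N)
    (L eta : R) zs z2 z1 z0 :
  0 < eta ->
  (forall u w, 2 * `|dotv (M *m u) w| <= L * (dotv u u + dotv w w)) ->
  (forall u, 0 <= dotv (M *m u) u) ->
  0 <= dotv (eta^-1 *: (z1 - z2) - 2 *: (M *m z1 + b) + (M *m z0 + b)
             - (- (M *m zs + b))) (z2 - zs) ->
  lyapunov M eta zs z2 z1
    + (2^-1 - eta * L) * (dotv (z2 - z1) (z2 - z1) + dotv (z1 - z0) (z1 - z0))
  <= lyapunov M eta zs z1 z0.
Proof.
move=> eta0 ML Mmon; rewrite /lyapunov.
set e := z2 - zs; set u := z2 - z1; set w := z1 - z0.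
have -> : z1 - zs = e - u by apply/colP => i; rewrite !mxE; ring.
have -> : eta^-1 *: (z1 - z2) - 2 *: (M *m z1 + b) + (M *m z0 + b)
    - (- (M *m zs + b)) = - (eta^-1 *: u) - M *m e + M *m u - M *m w.
  by rewrite !mulmxBr; apply/colP => i; rewrite !mxE; ring.
move/(ler_wpM2l (ltW eta0)); rewrite mulr0.
have := ler_wpM2l (ltW eta0) (ML w u).
have := ler_wpM2l (ltW eta0) (Mmon e).
have := ler_wpM2l (ltW eta0) (ler_norm (- dotv (M *m w) u)); rewrite normrN.
clearbody e u w; rewrite !dotv_lin (dotvC e u).
rewrite ![eta * (_ + _)]mulrDr [eta * - (eta^-1 * _)]mulrN mulVKf ?gt_eqF//.
lra.
Qed.

(** * Limits along ultrafilters *)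

Lemma ultra_map {T U : Type} (f : T -> U) (F : set_system T) :
  UltraFilter F -> UltraFilter (f @ F).
Proof.
move=> FU; split=> [|G GP FG]; first exact: fmap_proper_filter.
apply/seteqP; split=> [A GA|A]; last exact: FG.
(* Otherwise the preimage of the complement of [A] lies in [F], and the finer filter [G] contains
   both [A] and its complement. *)
have [//|FnA] := in_ultra_setVsetC (f @^-1` A) FU.
have : (G : set_system U) (A `&` ~` A) by apply: filterI => //; apply: FG.
by rewrite setICr => /filter_ex[].
Qed.

Lemma bounded_ultra_cvg {R : realType} {T : Type} {F : set_system T} {m}
    (z : T -> 'cV[R]_m) (a : 'cV[R]_m) (C : R) :
  UltraFilter F -> (forall x, dotv (z x - a) (z x - a) <= C) ->
  exists l : 'cV[R]_m, z @ F --> l.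
Proof.
move=> FU zC.
suff /choice[l zl] : forall i, exists l : R, z x i 0 @[x --> F] --> l.
  exists (\col_i l i); apply/cvg_mxP => i j; rewrite ord1 mxE; exact: zl.
move=> i.
have /= := @segment_compact R (a i 0 - (C + 1)) (a i 0 + (C + 1)).
rewrite compact_ultra => /(_ _ (ultra_map (fun x => z x i 0) _ FU)) /=.
case=> [|l [_ zl]]; last by exists l.
apply: filterE => x /=; rewrite in_itv/=.
have := le_trans (sqr_entry_le _ i) (zC x); rewrite !mxE.
(* These two squares give |t| <= t^2 + 1/4 for the deviation t of the entry, whence the radius C + 1
   of the compact segment. *)
have := sqr_ge0 (z x i 0 - a i 0 + 2^-1); have := sqr_ge0 (z x i 0 - a i 0 - 2^-1).
by move=> *; apply/andP; split; lra.
Qed.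

Lemma cvg_mulmx {R : realType} {T : Type} {F : set_system T} {FF : Filter F}
    {m n} (M : 'M[R]_(m, n)) (u : T -> 'cV[R]_n) a :
  u @ F --> a -> M *m u x @[x --> F] --> M *m a.
Proof.
move=> /cvg_mxP ua; apply/cvg_mxP => i j; rewrite mxE.
under eq_fun do rewrite mxE.
apply: cvg_big => [|k _]; first exact: add_continuous.
by apply: (cvgM (cvg_cst _)); exact: ua.
Qed.

Lemma cvg_dotv0 {R : realType} {T : Type} {F : set_system T} {FF : Filter F} {m}
    (u : T -> 'cV[R]_m) :
  dotv (u x) (u x) @[x --> F] --> (0 : R) -> u @ F --> (0 : 'cV[R]_m).
Proof.
move=> u0; apply/cvg_mxP => i j; rewrite ord1 mxE.
apply/cvgr0Pnorm_lt => e e0.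
have e20 : 0 < e ^+ 2 by rewrite exprn_gt0.
move/cvgr0Pnorm_lt : u0 => /(_ _ e20); apply: filterS => x.
rewrite ger0_norm ?dotv_ge0// => /(le_lt_trans (sqr_entry_le _ i)).
by rewrite -real_normK ?num_real// ltr_pXn2r// ?nnegrE ?ltW.
Qed.

(** * Convergence of the forward-reflected-backward splitting *)

(** [T] is the graph of a set-valued monotone operator, and the last hypothesis is the resolvent
    step written as membership in that graph. Closedness is asked along any proper filter so that it
    applies to an ultrafilter. *)
Theorem forward_reflected_backward_cvg {R : realType} {N}
    (T : 'cV[R]_N -> 'cV[R]_N -> Prop) (M : 'M[R]_N) (b : 'cV[R]_N)
    (L eta : R) (zs : 'cV[R]_N) (z : nat -> 'cV[R]_N) :
  (forall u v u' v', T u v -> T u' v' -> 0 <= dotv (v - v') (u - u')) ->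
  (forall (F : set_system nat) u v u0 v0, ProperFilter F ->
    (forall k, T (u k) (v k)) -> u @ F --> u0 -> v @ F --> v0 -> T u0 v0) ->
  0 < eta -> 2 * (eta * L) < 1 ->
  (forall u w, 2 * `|dotv (M *m u) w| <= L * (dotv u u + dotv w w)) ->
  (forall u, 0 <= dotv (M *m u) u) ->
  T zs (- (M *m zs + b)) ->
  (forall k, T (z k.+2) (eta^-1 *: (z k.+1 - z k.+2) - 2 *: (M *m z k.+1 + b)
                         + (M *m z k + b))) ->
  exists2 l : 'cV[R]_N, z @ \oo --> l & T l (- (M *m l + b)).
Proof.
move=> Tmon Tclosed eta0 etaL ML Mmon Tzs Tz.
pose phi zs k := lyapunov M eta zs (z k.+1) (z k).
have phi_ge x k : 2^-1 * dotv (z k.+1 - x) (z k.+1 - x) <= phi x k.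
  exact: lyapunov_ge eta0 etaL ML.
have phi_ge0 x k : 0 <= phi x k.
  by apply: le_trans (phi_ge x k); rewrite mulr_ge0 ?dotv_ge0.
(* Stated for every zero x: it serves first at [zs], then at the cluster point [l]. *)
have step x k : T x (- (M *m x + b)) -> phi x k.+1
    + (2^-1 - eta * L) * (dotv (z k.+2 - z k.+1) (z k.+2 - z k.+1)
                          + dotv (z k.+1 - z k) (z k.+1 - z k)) <= phi x k.
  move=> Tx; apply: (lyapunov_step M b L eta x _ _ _ eta0 ML Mmon).
  exact: Tmon _ _ _ _ (Tz k) Tx.
have delta0 : 0 < 2^-1 - eta * L by lra.
have phi_noninc x : T x (- (M *m x + b)) -> nonincreasing_seq (phi x).
  move=> Tx; apply/nonincreasing_seqP => k; apply: le_trans (step x k Tx).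
  by rewrite lerDl mulr_ge0 ?(ltW delta0)// addr_ge0 ?dotv_ge0.
have phi_cvg x : T x (- (M *m x + b)) -> cvgn (phi x).
  move=> Tx; apply: nonincreasing_is_cvgn; first exact: phi_noninc.
  by exists 0 => _ [k _ <-].
(* Each squared increment is at most a constant times the drop of [phi zs], and the drops of a
   convergent sequence tend to 0. *)
have dd0 : (fun k => dotv (z k.+1 - z k) (z k.+1 - z k)) @ \oo --> (0 : R).
  have dphi : (fun k => (2^-1 - eta * L)^-1 * (phi zs k - phi zs k.+1)) @ \oo
      --> (0 : R).
    rewrite -(mulr0 (2^-1 - eta * L)^-1); apply: (cvgM (cvg_cst _)).
    rewrite -(subrr (limn (phi zs))); apply: cvgB; first exact: phi_cvg.
    rewrite (cvg_shiftS (phi zs)); exact: phi_cvg.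
  apply: (squeeze_cvgr _ (cvg_cst 0) dphi); apply: nearW => k.
  rewrite dotv_ge0/= -ler_pdivrMl ?invr_gt0// invrK.
  have := step zs k Tzs.
  have := dotv_ge0 (z k.+2 - z k.+1); nra.
have d0 : (fun k => z k.+1 - z k) @ \oo --> (0 : 'cV[R]_N) by exact: cvg_dotv0.
have [U [UU ooU]] := @ultraFilterLemma _ \oo _.
have UP : ProperFilter U by exact: ultra_proper.
have cvgU (V : topologicalType) (u : nat -> V) (l : V) :
    u @ \oo --> l -> u @ U --> l.
  by move=> ul A /ul; exact: ooU.
have [l zl2] : exists l : 'cV[R]_N, z k.+2 @[k --> U] --> l.
  apply: (bounded_ultra_cvg _ zs (2 * phi zs 0%N)) => k.
  have := phi_ge zs k.+1; have := phi_noninc zs Tzs 0%N k.+1 isT; lra.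
(* A limit along [U] does not pass to shifted sequences by itself; the vanishing increments carry it
   from [z k.+2] down to [z k]. *)
have zl1 : z k.+1 @[k --> U] --> l.
  rewrite -(subr0 l).
  rewrite (_ : (fun k => z k.+1) = (fun k => z k.+2 - (z k.+2 - z k.+1))).
    apply: cvgB zl2 (cvgU _ (fun k => z k.+2 - z k.+1) _ _).
    by rewrite (cvg_shiftS (fun k => z k.+1 - z k)).
  by apply/funext => k; rewrite opprB addrC subrK.
have zl0 : z k @[k --> U] --> l.
  rewrite -(subr0 l).
  rewrite (_ : (fun k => z k) = (fun k => z k.+1 - (z k.+1 - z k))).
    exact: cvgB zl1 (cvgU _ _ _ d0).
  by apply/funext => k; rewrite opprB addrC subrK.
(* In the limit the difference quotient vanishes and -2 B l + B l = - B l remains. *)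
have Tl : T l (- (M *m l + b)).
  apply: (Tclosed U _ _ _ _ UP Tz zl2).
  rewrite (_ : - (M *m l + b)
    = eta^-1 *: (l - l) - 2 *: (M *m l + b) + (M *m l + b)); last first.
    move: (M *m l + b) => X.
    by rewrite subrr scaler0 sub0r scaler_nat mulr2n opprD addrNK.
  have cvgM u : u @ U --> l -> M *m u k + b @[k --> U] --> M *m l + b.
    by move=> ul; apply: cvgD; [exact: cvg_mulmx | exact: cvg_cst].
  apply: cvgD (cvgM _ zl0); apply: cvgB;
    apply: (cvgZ (cvg_cst _)) => //; last exact: cvgM.
  exact: cvgB.
exists l => //.
(* As [l] is a zero, [phi l] converges along [\oo]; its limit can therefore be computed along [U],
   where all terms vanish. *)
have phi0 : phi l @ \oo --> (0 : R).
  suff <- : limn (phi l) = 0 by exact: phi_cvg.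
  apply: (@cvg_unique _ _ (phi l @ U)) => //.
    exact: cvgU _ _ _ (phi_cvg l Tl).
  have dU : z k.+1 - z k @[k --> U] --> (0 : 'cV[R]_N).
    exact: cvgU _ _ _ d0.
  have eU : z k.+1 - l @[k --> U] --> (0 : 'cV[R]_N).
    by rewrite -(subrr l); apply: cvgB => //; exact: cvg_cst.
  rewrite (_ : 0 = dotv 0 (0 : 'cV[R]_N)
    - 2 * eta * dotv (M *m 0) (0 : 'cV[R]_N)
    + 2^-1 * dotv 0 (0 : 'cV[R]_N)); last by rewrite mulmx0 !dotv0l; ring.
  apply: cvgD; last by apply: (cvgM (cvg_cst _)); exact: cvg_dotv.
  apply: cvgB; first exact: cvg_dotv.
  by apply: (cvgM (cvg_cst _)); apply: cvg_dotv => //; exact: cvg_mulmx.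
rewrite -(cvg_shiftS z) -(addr0 l).
rewrite (_ : [sequence _]_n = (fun k => l + (z k.+1 - l))); last first.
  by apply/funext => k; rewrite addrC subrK.
apply: cvgD; first exact: cvg_cst.
apply: cvg_dotv0.
have phi20 : (fun k => 2 * phi l k) @ \oo --> (0 : R).
  by rewrite -(mulr0 2); exact: (cvgM (cvg_cst _)).
apply: (squeeze_cvgr _ (cvg_cst 0) phi20); apply: nearW => k.
by rewrite dotv_ge0/=; have := phi_ge l k; lra.
Qed.

(** * Subgradients and the proximal step *)

(** Finiteness is part of the notion: the inequality alone also holds where [f x = -oo], and
    everywhere if [f] is identically [+oo]. *)
Definition subgradient {R : realType} {m} (f : 'cV[R]_m -> \bar R)
    (x v : 'cV[R]_m) : Prop :=
  f x \is a fin_num /\ forall u, (f x + (dotv v (u - x))%:E <= f u)%E.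

Lemma subgradient_monotone {R : realType} {m} (f : 'cV[R]_m -> \bar R)
    x v x' v' :
  subgradient f x v -> subgradient f x' v' -> 0 <= dotv (v - v') (x - x').
Proof.
move=> [/fineK fx /(_ x') sx] [/fineK fx' /(_ x) sx'].
move: sx sx'; rewrite -fx -fx' -!EFinD !lee_fin.
rewrite -(opprB x x') !dotv_lin; lra.
Qed.

(** For fixed w the subgradient inequality says that (u k, f w - <v k, w - u k>) lies in the
    epigraph, which is closed. *)
Lemma subgradient_closed {R : realType} {m} (f : 'cV[R]_m -> \bar R)
    {T : Type} (F : set_system T) (u v : T -> 'cV[R]_m) u0 v0 :
  ProperFilter F -> proper_fun f -> closed_fun f ->
  (forall k, subgradient f (u k) (v k)) ->
  u @ F --> u0 -> v @ F --> v0 -> subgradient f u0 v0.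
Proof.
move=> FF [fNy [w0 fw0]] fcl fuv uu0 vv0.
have epi w : f w \is a fin_num -> (f u0 <= (fine (f w) - dotv v0 (w - u0))%:E)%E.
  move=> fw; pose a k := fine (f w) - dotv (v k) (w - u k).
  suff : [set xa : 'cV[R]_m * R | (f xa.1 <= xa.2%:E)%E]
    (u0, fine (f w) - dotv v0 (w - u0)) by [].
  refine (@closed_cvg _ _ F FF (fun k => (u k, a k)) _ fcl _ _ _).
    apply: nearW => k /=; have [fuk /(_ w)] := fuv k.
    by rewrite -(fineK fuk) -(fineK fw) -EFinD !lee_fin /a; lra.
  apply: (cvg_pair uu0 (_ : a @ F --> (fine (f w) - dotv v0 (w - u0)))).
  apply: cvgB; first exact: cvg_cst.
  by apply: cvg_dotv => //; apply: cvgB => //; exact: cvg_cst.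
have fu0 : f u0 \is a fin_num.
  by rewrite fin_numE fNy lt_eqF// (le_lt_trans (epi _ fw0)) ?ltry.
split=> // w; have [->|fwy] := eqVneq (f w) +oo%E; first by rewrite leey.
have fw : f w \is a fin_num by rewrite fin_numE fNy.
have := epi _ fw; rewrite -(fineK fu0) -(fineK fw) -EFinD !lee_fin; lra.
Qed.

(** Comparing the minimiser with t w + (1 - t) x, using convexity and dividing by t gives [key];
    letting t tend to 0 removes the quadratic remainder. *)
Lemma prox_subgradient {R : realType} {m} (f : 'cV[R]_m -> \bar R) (eta : R)
    (x xhat : 'cV[R]_m) :
  0 < eta -> proper_fun f -> convex_fun f ->
  (forall u, eta%:E * f x + (2^-1 * enorm2 (x - xhat))%:E
             <= eta%:E * f u + (2^-1 * enorm2 (u - xhat))%:E)%E ->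
  subgradient f x (eta^-1 *: (xhat - x)).
Proof.
move=> eta0 [fNy [w0 /fineK fw0]] fcvx xmin.
have fx : f x \is a fin_num.
  have := xmin w0; rewrite fin_numE fNy -fw0 /=.
  by case: (f x) => //=; rewrite gt0_muley ?lte_fin// addye//.
split=> // w; have [->|fwy] := eqVneq (f w) +oo%E; first by rewrite leey.
have fw : f w \is a fin_num by rewrite fin_numE fNy.
have key t : 0 < t < 1 -> eta * (fine (f x) - fine (f w))
    <= dotv (x - xhat) (w - x) + t * (2^-1 * dotv (w - x) (w - x)).
  move=> t01; have /andP[t0 t1] := t01.
  have := xmin (t *: w + (1 - t) *: x).
  have := fcvx w x t t01; set fm := f (_ + _).
  rewrite -(fineK fx) -(fineK fw) -!EFinM -!EFinD.
  have := fNy (t *: w + (1 - t) *: x); rewrite -/fm.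
  case: fm => //= fm _; rewrite -?EFinM -?EFinD !lee_fin !enorm2E => fmle.
  have -> : t *: w + (1 - t) *: x - xhat = (x - xhat) + t *: (w - x).
    by apply/colP => i; rewrite !mxE; ring.
  move: (x - xhat) (w - x) => d e.
  rewrite !dotv_lin (dotvC e d) => xm.
  rewrite -(ler_pM2l t0).
  have := ler_wpM2l (ltW eta0) fmle; lra.
rewrite -(fineK fx) -(fineK fw) -EFinD lee_fin -(ler_pM2l eta0) mulrDr dotvZl.
rewrite mulVKf ?gt_eqF// -(opprB x xhat) dotvNl.
suff : eta * (fine (f x) - fine (f w)) <= dotv (x - xhat) (w - x) by lra.
apply/ler_addgt0Pr => e e0.
set D := 2^-1 * dotv (w - x) (w - x).
have D0 : 0 <= D by rewrite mulr_ge0 ?dotv_ge0.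
have De : 0 < D + e by rewrite ltr_wpDl.
(* This t lies in (0, 1) and satisfies t D <= e. *)
have := key (e / (D + e + 1)) _; rewrite -/D.
have D1 : 0 < D + e + 1 by rewrite addr_gt0.
rewrite divr_gt0// ltr_pdivrMr// mul1r.
have -> : e < D + e + 1 by lra.
move=> /(_ isT) /le_trans; apply; rewrite lerD2l mulrAC ler_pdivrMr//; nra.
Qed.

(** * Block structure of [Mtilde] *)

Lemma Mtilde_mul {R : realType} {q p : nat} {n : 'I_q -> nat}
    (A : forall i : 'I_q, 'M[R]_(p, n i)) (rho : R)
    (x : forall i, 'cV[R]_(n i)) (y : 'cV[R]_p) :
  Mtilde A rho *m col_mx (\mxcol_i x i) y
  = col_mx (\mxcol_i ((A i)^T *m (rho *: (\sum_j A j *m x j) + y)))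
           (- (\sum_j A j *m x j)).
Proof.
rewrite /Mtilde mul_block_col mul0mx addr0; congr col_mx; last first.
  by rewrite mul_mxrow_mxcol -sumrN; apply: eq_bigr => j _; rewrite mulNmx.
rewrite mxblockEv !mxcol_mul -mxcolD; apply/eq_mxcolP => i.
rewrite mul_mxrow_mxcol mulmxDr -scalemxAr mulmx_sumr scaler_sumr.
by congr (_ + _); apply: eq_bigr => j _; rewrite -scalemxAl mulmxA.
Qed.

Lemma dotv_col_mx {R : realType} {m p} (x x' : 'cV[R]_m) (y y' : 'cV[R]_p) :
  dotv (col_mx x y) (col_mx x' y') = dotv x x' + dotv y y'.
Proof. by rewrite /dotv tr_col_mx mul_row_col mxE. Qed.

Lemma dotv_mxcol {R : realType} {q : nat} {n : 'I_q -> nat}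
    (x x' : forall i, 'cV[R]_(n i)) :
  dotv (\mxcol_i x i) (\mxcol_i x' i) = \sum_i dotv (x i) (x' i).
Proof. by rewrite /dotv tr_mxcol mul_mxrow_mxcol summxE. Qed.

Lemma dotv_blocks {R : realType} {q p : nat} {n : 'I_q -> nat}
    (u v : 'cV[R]_(\sum_i n i + p)) :
  dotv u v = \sum_i dotv (submxcol (usubmx u) i) (submxcol (usubmx v) i)
             + dotv (dsubmx u) (dsubmx v).
Proof.
by rewrite -{1}(vsubmxK u) -{1}(vsubmxK v) dotv_col_mx -dotv_mxcol !submxcolK.
Qed.

Lemma dotv_suml {R : realType} {m} {I : finType} (u : I -> 'cV[R]_m) v :
  dotv (\sum_i u i) v = \sum_i dotv (u i) v.
Proof.
by rewrite (big_morph (fun w => dotv w v) (fun a b => dotvDl a b v) (dotv0l v)).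
Qed.

Lemma dotv_sumr {R : realType} {m} {I : finType} (u : I -> 'cV[R]_m) v :
  dotv v (\sum_i u i) = \sum_i dotv v (u i).
Proof. by rewrite dotvC dotv_suml; apply: eq_bigr => i _; rewrite dotvC. Qed.

(** The off-diagonal blocks are skew and cancel, leaving rho |sum_j A_j x_j|^2. *)
Lemma Mtilde_monotone {R : realType} {q p : nat} {n : 'I_q -> nat}
    (A : forall i : 'I_q, 'M[R]_(p, n i)) (rho : R) z :
  0 <= rho -> 0 <= dotv (Mtilde A rho *m z) z.
Proof.
move=> rho0; rewrite -(vsubmxK z) -(submxcolK (usubmx z)).
set x := submxcol _; set y := dsubmx z; rewrite Mtilde_mul dotv_col_mx dotv_mxcol.
under eq_bigr do rewrite dotv_trmx.
rewrite -dotv_sumr !dotv_lin (dotvC y) addrK.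
by rewrite mulr_ge0 ?dotv_ge0.
Qed.

(** * The saddle operator and its zeros *)

Definition saddle_op {R : realType} {q p : nat} {n : 'I_q -> nat}
    (f : forall i : 'I_q, 'cV[R]_(n i) -> \bar R)
    (z v : 'cV[R]_(\sum_i n i + p)) : Prop :=
  (forall i, subgradient (f i) (submxcol (usubmx z) i) (submxcol (usubmx v) i))
  /\ dsubmx v = 0.

Lemma saddle_op_monotone {R : realType} {q p : nat} {n : 'I_q -> nat}
    (f : forall i : 'I_q, 'cV[R]_(n i) -> \bar R)
    (z v z' v' : 'cV[R]_(\sum_i n i + p)) :
  saddle_op f z v -> saddle_op f z' v' -> 0 <= dotv (v - v') (z - z').
Proof.
move=> [zv v0] [zv' v0'].
rewrite dotv_blocks !linearB/= v0 v0' subrr dotv0l addr0.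
rewrite sumr_ge0// => i _; rewrite !submxcolB.
exact: subgradient_monotone (zv i) (zv' i).
Qed.

Lemma cvg_block {R : realType} {q p : nat} {n : 'I_q -> nat}
    {T : Type} {F : set_system T} {FF : Filter F}
    (w : T -> 'cV[R]_(\sum_i n i + p)) (w0 : 'cV[R]_(\sum_i n i + p)) i :
  w @ F --> w0 ->
  submxcol (usubmx (w x)) i @[x --> F] --> submxcol (usubmx w0) i.
Proof.
move=> /cvg_mxP ww0; apply/cvg_mxP => j k; rewrite !mxE.
by under eq_fun do rewrite !mxE; exact: ww0.
Qed.

Lemma saddle_op_closed {R : realType} {q p : nat} {n : 'I_q -> nat}
    (f : forall i : 'I_q, 'cV[R]_(n i) -> \bar R)
    {T : Type} (F : set_system T) (u v : T -> 'cV[R]_(\sum_i n i + p)) u0 v0 :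
  ProperFilter F -> (forall i, proper_fun (f i)) -> (forall i, closed_fun (f i)) ->
  (forall k, saddle_op f (u k) (v k)) ->
  u @ F --> u0 -> v @ F --> v0 -> saddle_op f u0 v0.
Proof.
move=> FF fP fC fuv uu0 vv0.
split=> [i|].
  apply: (subgradient_closed _ F _ _ _ _ FF (fP i) (fC i) _ (cvg_block _ _ i uu0)
    (cvg_block _ _ i vv0)) => k.
  exact: (fuv k).1.
apply/colP => j; rewrite !mxE.
have /cvg_mxP/= vv0' := vv0; have := vv0' (rshift _ j) 0.
rewrite (_ : (fun k => _) = fun=> 0); last first.
  by apply/funext => k; have /colP/(_ j) := (fuv k).2; rewrite !mxE.
by move=> /(cvg_unique _ (cvg_cst 0)) <-.
Qed.

Definition saddle_cst {R : realType} {q p : nat} {n : 'I_q -> nat}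
    (A : forall i : 'I_q, 'M[R]_(p, n i)) (c : 'cV[R]_p) (rho : R) :
    'cV[R]_(\sum_i n i + p) :=
  col_mx (\mxcol_i (- (rho *: ((A i)^T *m c)))) c.

(** With r = sum_j A_j x_j - c, this is the x-gradient and minus the y-gradient of the augmented
    coupling <y, r> + rho/2 |r|^2. *)
Lemma Mtilde_affine {R : realType} {q p : nat} {n : 'I_q -> nat}
    (A : forall i : 'I_q, 'M[R]_(p, n i)) (c : 'cV[R]_p) (rho : R)
    (x : forall i, 'cV[R]_(n i)) (y : 'cV[R]_p) :
  Mtilde A rho *m col_mx (\mxcol_i x i) y + saddle_cst A c rho
  = col_mx (\mxcol_i ((A i)^T *m (rho *: (\sum_j A j *m x j - c) + y)))
           (c - \sum_j A j *m x j).
Proof.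
rewrite Mtilde_mul /saddle_cst add_col_mx -mxcolD; congr col_mx; last first.
  by rewrite addrC.
apply/eq_mxcolP => i; rewrite scalerBr !(mulmxDr, mulmxN) -!scalemxAr.
by rewrite addrAC.
Qed.

(** The y block forces feasibility, and then the penalty term in [rho] vanishes from the x
    blocks. *)
Lemma saddle_op_kktP {R : realType} {q p : nat} {n : 'I_q -> nat}
    (f : forall i : 'I_q, 'cV[R]_(n i) -> \bar R)
    (A : forall i : 'I_q, 'M[R]_(p, n i)) (c : 'cV[R]_p) (rho : R)
    (x : forall i, 'cV[R]_(n i)) (y : 'cV[R]_p) (z := col_mx (\mxcol_i x i) y) :
  saddle_op f z (- (Mtilde A rho *m z + saddle_cst A c rho)) <->
  \sum_i A i *m x i = c /\ forall i, subgradient (f i) (x i) (- ((A i)^T *m y)).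
Proof.
rewrite /z Mtilde_affine /saddle_op opp_col_mx !col_mxKu !col_mxKd opprB.
rewrite -mxcolN; split=> [[fz /eqP]|[-> fz]].
  rewrite subr_eq0 => /eqP xc; split=> // i.
  by have := fz i; rewrite !mxcolK xc subrr scaler0 add0r.
by split=> [i|]; rewrite ?subrr// !mxcolK scaler0 add0r.
Qed.

(** Summing the subgradient inequalities at a feasible [z] leaves the linear term - <y, sum A_i (z_i
    - x_i)>, which is 0. *)
Lemma kkt_solution {R : realType} {q p : nat} {n : 'I_q -> nat}
    (f : forall i : 'I_q, 'cV[R]_(n i) -> \bar R)
    (A : forall i : 'I_q, 'M[R]_(p, n i)) (c : 'cV[R]_p)
    (x : forall i, 'cV[R]_(n i)) (y : 'cV[R]_p) :
  \sum_i A i *m x i = c ->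
  (forall i, subgradient (f i) (x i) (- ((A i)^T *m y))) ->
  is_solution f A c x.
Proof.
move=> xc fx; split=> // z zc.
have lin0 : \sum_i dotv (- ((A i)^T *m y)) (z i - x i) = 0.
  under eq_bigr do rewrite dotvNl dotv_trmx mulmxBr.
  by rewrite sumrN -dotv_sumr sumrB xc zc subrr dotvC dotv0l oppr0.
have := lee_sum (index_enum 'I_q) (fun i _ => (fx i).2 (z i)) (P := xpredT).
by rewrite big_split/= sumEFin lin0 adde0.
Qed.

Lemma saddle_kkt {R : realType} {q p : nat} {n : 'I_q -> nat}
    (f : forall i : 'I_q, 'cV[R]_(n i) -> \bar R)
    (A : forall i : 'I_q, 'M[R]_(p, n i)) (c : 'cV[R]_p)
    (x : forall i, 'cV[R]_(n i)) (y : 'cV[R]_p) :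
  (forall i, proper_fun (f i)) ->
  (forall x' y', (lagr0 f A c x y' <= lagr0 f A c x y)%E /\
                 (lagr0 f A c x y <= lagr0 f A c x' y)%E) ->
  \sum_i A i *m x i = c /\ forall i, subgradient (f i) (x i) (- ((A i)^T *m y)).
Proof.
move=> fP xy.
(* Minimality against a point [w] of finite values excludes [+oo]. *)
have fx : (\sum_i f i (x i))%E \is a fin_num.
  pose w i := projT1 (cid (fP i).2).
  have fw i : f i (w i) \is a fin_num by exact: projT2 (cid (fP i).2).
  have /fineK sw : (\sum_i f i (w i))%E \is a fin_num by exact/sum_fin_numP.
  have := (xy w y).2; rewrite /lagr0 -sw.
  have : (\sum_i f i (x i))%E != -oo%E.
    by rewrite esum_eqNy; apply/existsPn => i; rewrite (fP i).1.
  by case: (\sum_i f i (x i))%E.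
have fxi i : f i (x i) \is a fin_num.
  by move/sum_fin_numP : fx; apply=> //; rewrite mem_index_enum.
split.
  apply/eqP; rewrite -subr_eq0; apply/eqP.
  set r := _ - c.
  (* Moving the multiplier by the residual r turns maximality in y into |r|^2 <= 0. *)
  have := (xy x (y + r)).1; rewrite /lagr0 -/r -(fineK fx) -!EFinD lee_fin lerD2l.
  rewrite dotvDl gerDl => r0; apply/colP => i; rewrite [RHS]mxE; apply/eqP.
  by rewrite -sqrf_eq0 eq_le sqr_ge0 (le_trans (sqr_entry_le _ _)).
move=> i; split=> // u.
have [->|fuy] := eqVneq (f i u) +oo%E; first by rewrite leey.
have fu : f i u \is a fin_num by rewrite fin_numE (fP i).1.
(* Changing only block i makes all other summands cancel in the minimality inequality. *)
pose xu := eqtype.dfwith x u.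
have xui : xu i = u by rewrite /xu dfwith_in.
have xuj j : j != i -> xu j = x j by move=> ji; rewrite /xu dfwith_out// eq_sym.
have := (xy xu y).2; rewrite /lagr0 !(bigD1 i (P := xpredT))//= xui.
have -> : (\sum_(j < q | j != i) f j (xu j) = \sum_(j < q | j != i) f j (x j))%E.
  by apply: eq_bigr => j /xuj ->.
have -> : \sum_(j < q | j != i) A j *m xu j = \sum_(j < q | j != i) A j *m x j.
  by apply: eq_bigr => j /xuj ->.
have /fineK <- : (\sum_(j < q | j != i) f j (x j))%E \is a fin_num.
  exact/sum_fin_numP.
rewrite -(fineK fu) -(fineK (fxi i)) -!EFinD !lee_fin.
rewrite !dotv_lin !dotv_trmx; lra.
Qed.

Lemma submxcolZ {R : pzRingType} {q : nat} {n : 'I_q -> nat} {m} (a : R)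
    (B : 'M[R]_(\sum_i n i, m)) i :
  submxcol (a *: B) i = a *: submxcol B i.
Proof. by apply/matrixP => j k; rewrite !mxE. Qed.

(* xs k = x_{k-1}, ys k = y_{k-1}  (index shift so that k >= -1 becomes k >= 0) *)
Theorem theorem2 (R : realType) (q p : nat) (n : 'I_q -> nat)
    (f : forall i : 'I_q, 'cV[R]_(n i) -> \bar R)
    (A : forall i : 'I_q, 'M[R]_(p, n i)) (c : 'cV[R]_p)
    (rho Lt eta : R)
    (xs : nat -> forall i : 'I_q, 'cV[R]_(n i)) (ys : nat -> 'cV[R]_p) :
  (forall i, proper_fun (f i)) ->
  (forall i, closed_fun (f i)) ->
  (forall i, convex_fun (f i)) ->
  (exists (xst : forall i : 'I_q, 'cV[R]_(n i)) (yst : 'cV[R]_p),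
     forall (x : forall i : 'I_q, 'cV[R]_(n i)) (y : 'cV[R]_p),
       (lagr0 f A c xst y <= lagr0 f A c xst yst)%E /\
       (lagr0 f A c xst yst <= lagr0 f A c x yst)%E) ->
  0 <= rho ->
  0 < Lt ->
  specnorm (Mtilde A rho) <= Lt ->
  0 < eta < (2 * Lt)^-1 ->
  (forall k (i : 'I_q),
     let xhat := xs k.+1 i - (2 * eta) *: ((A i)^T *m ys k.+1)
                 - (2 * eta * rho) *: (\sum_(j < q) (A i)^T *m A j *m xs k.+1 j)
                 + eta *: ((A i)^T *m ys k)
                 + (eta * rho) *: (\sum_(j < q) (A i)^T *m A j *m xs k j)
                 + (eta * rho) *: ((A i)^T *m c) in
     forall u : 'cV[R]_(n i),
       (eta%:E * f i (xs k.+2 i) + (2^-1 * enorm2 (xs k.+2 i - xhat))%:E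
        <= eta%:E * f i u + (2^-1 * enorm2 (u - xhat))%:E)%E) ->
  (forall k,
     ys k.+2 = ys k.+1 + (2 * eta) *: (\sum_(i < q) A i *m xs k.+1 i)
               - eta *: (\sum_(i < q) A i *m xs k i) - eta *: c) ->
  exists xstar : forall i : 'I_q, 'cV[R]_(n i),
    (forall i, (fun k => xs k i) @ \oo --> xstar i) /\
    is_solution f A c xstar.
Proof.
move=> fP fC fV [xst [yst xyst]] rho0 Lt0 MLt /andP[eta0 etaL] xsP ysP.
pose z k : 'cV[R]_(\sum_i n i + p) := col_mx (\mxcol_i xs k i) (ys k).
have etaL' : 2 * (eta * Lt) < 1.
  by rewrite mulrCA -ltr_pdivlMr ?mulr_gt0// mul1r.
have MtL := ler_dotv_lipschitz _ _ Lt0 (specnorm_bound _ _ MLt Lt0).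
have /(saddle_op_kktP _ _ _ rho) zst := saddle_kkt f A c xst yst fP xyst.
have zP k : saddle_op f (z k.+2) (eta^-1 *: (z k.+1 - z k.+2)
    - 2 *: (Mtilde A rho *m z k.+1 + saddle_cst A c rho)
    + (Mtilde A rho *m z k + saddle_cst A c rho)).
  rewrite !Mtilde_affine /saddle_op !linearD !linearN !linearZ/=.
  rewrite !col_mxKu !col_mxKd; split=> [i|].
    rewrite !(submxcolD, submxcolN, submxcolZ) !mxcolK.
    (* The prox step yields the subgradient (xhat - x)/eta, which is the i-th block of the required
       vector after expanding xhat. *)
    have := prox_subgradient (f i) eta _ _ eta0 (fP i) (fV i) (xsP k i).
    congr (subgradient _ _ _).
    have sumA j : \sum_(i0 < q) (A i)^T *m A i0 *m xs j i0
        = (A i)^T *m \sum_i0 A i0 *m xs j i0.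
      by rewrite mulmx_sumr; apply: eq_bigr => i0 _; rewrite mulmxA.
    rewrite !sumA !(mulmxDr, mulmxN) -!scalemxAr !(mulmxDr, mulmxN).
    apply/colP => l; rewrite !mxE; field.
    by rewrite gt_eqF.
  (* The explicit update of y says exactly that the y block is 0. *)
  rewrite ysP; apply/colP => l; rewrite !mxE; field.
  by rewrite gt_eqF.
have [l zl lP] := forward_reflected_backward_cvg (saddle_op f) _ _ _ _ _ z
  (saddle_op_monotone f)
  (fun F u v u0 v0 FF => saddle_op_closed f F u v u0 v0 FF fP fC)
  eta0 etaL' MtL (fun u => Mtilde_monotone A rho u rho0) zst zP.
exists (fun i => submxcol (usubmx l) i); split=> [i|].
  rewrite (_ : (fun k => xs k i) = fun k => submxcol (usubmx (z k)) i).
    exact: cvg_block.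
  by apply/funext => k; rewrite /z col_mxKu mxcolK.
move: lP; rewrite -(vsubmxK l) -(submxcolK (usubmx l)).
by move=> /saddle_op_kktP[]; rewrite col_mxKu submxcolK; exact: kkt_solution.
Qed.
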